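(* Let $A\in\mathbb{R}^{n\times d}$, $b\in\mathbb{R}^n$, $f(x):=\|Ax-b\|_2^2$ and $x^*=\arg\min_x f(x)$. For any i.i.d. sketching matrices $S_k\in\mathbb{R}^{m\times n}$, $k=1,\dots,q$, the expected objective value difference for the averaged estimator $\bar{x}=\frac1q\sum_{k=1}^q\hat{x}_k$, where $\hat{x}_k=\arg\min_x\|S_kAx-S_kb\|_2^2$, can be decomposed as $$\mathbb{E}[f(\bar{x})]-f(x^* )=\frac1q\,\mathbb{E}\left[\|A\hat{x}-Ax^*\|_2^2\right]+\frac{q-1}{q}\,\big\|\mathbb{E}[A\hat{x}]-Ax^*\big\|_2^2,$$ where $\hat{x}$ is the single sketch estimator.
   Context: The single sketch estimator is $\hat{x}=\arg\min_x\|SAx-Sb\|_2^2$ with $S$ distributed as the $S_k$. Sketching matrices are random matrices scaled such that $\mathbb{E}[S^TS]=I_n$. Expectations are over the sketching matrices only; $A$ and $b$ are deterministic. *)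

(* Defs.v *)
From HB Require Import structures.
From mathcomp Require Export all_boot all_order all_algebra.
From mathcomp Require Export all_classical all_reals all_analysis.

Set Implicit Arguments.
Unset Strict Implicit.
Unset Printing Implicit Defensive.

Import Order.TTheory GRing.Theory Num.Theory.
Import numFieldNormedType.Exports.

Local Open Scope classical_set_scope.
Local Open Scope ring_scope.

(* Real matrices carry the Borel sigma-algebra of their product topology, so
   that [{RV P >-> 'M[R]_(m, n)}] is the type of random matrices. *)
HB.instance Definition _ (R : realType) (m n : nat) :=
  @isMeasurable.Build (sigma_display (@open 'M[R]_(m, n))) 'M[R]_(m, n)
    <<s (@open 'M[R]_(m, n)) >>
    (@sigma_algebra0 _ setT (@open 'M[R]_(m, n)))
    (@sigma_algebraC _ (@open 'M[R]_(m, n)))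
    (@sigma_algebra_bigcup _ setT (@open 'M[R]_(m, n))).

(* The library norm on matrices is the max norm. *)
Definition norm2 (R : realType) (n : nat) (v : 'cV[R]_n) : R :=
  Num.sqrt (\sum_(i < n) v i 0 ^+ 2).

Definition lsq (R : realType) (n d : nat) (A : 'M[R]_(n, d)) (b : 'cV[R]_n)
    (x : 'cV[R]_d) : R :=
  norm2 (A *m x - b) ^+ 2.

Definition argmin (R : realType) (X : Type) (f : X -> R) : set X :=
  [set x | forall y, f x <= f y].

(* Equality is required on measurable sets only: [distribution P X] is a
   function on all sets and is meaningless elsewhere. *)
Definition same_law (R : realType) (d d' : measure_display)
    (T : measurableType d) (T' : measurableType d') (P : probability T R)
    (X Y : {RV P >-> T'}) : Prop :=
  forall B : set T', measurable B -> distribution P X B = distribution P Y B.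

Definition mutually_independent (R : realType) (d d' : measure_display)
    (T : measurableType d) (T' : measurableType d') (P : probability T R)
    (I : finType) (X : I -> {RV P >-> T'}) : Prop :=
  forall (J : {set I}) (B : I -> set T'),
    (forall k, k \in J -> measurable (B k)) ->
    P (\bigcap_(k in [set` J]) (X k @^-1` B k)) =
    (\prod_(k in J) P (X k @^-1` B k))%E.

Definition iid (R : realType) (d d' : measure_display)
    (T : measurableType d) (T' : measurableType d') (P : probability T R)
    (I : finType) (X : I -> {RV P >-> T'}) : Prop :=
  mutually_independent X /\ forall k l, same_law (X k) (X l).

Definition mx_expectation (R : realType) (d : measure_display)
    (T : measurableType d) (P : probability T R) (m n : nat)
    (X : T -> 'M[R]_(m, n)) : 'M[\bar R]_(m, n) :=
  \matrix_(i < m, j < n) 'E_P[fun w => X w i j]%E.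

(* The diagonal entries of E[S^T S] are integrals of nonnegative functions, so
   this equation already forces the entries of S to be square integrable. *)
Definition sketching (R : realType) (d : measure_display)
    (T : measurableType d) (P : probability T R) (m n : nat)
    (S : {RV P >-> 'M[R]_(m, n)}) : Prop :=
  mx_expectation P (fun w => (S w)^T *m S w) = map_mx EFin 1%:M.

(* A choice of minimizer M |-> argmin_x |M A x - M b|_2^2. When M A lacks full
   column rank the minimizer is not unique; the choice then only has to be a
   measurable function of the sketch M. *)
Definition sketched_argmin (R : realType) (m n d : nat) (A : 'M[R]_(n, d))
    (b : 'cV[R]_n) (sol : 'M[R]_(m, n) -> 'cV[R]_d) : Prop :=
  measurable_fun setT sol /\
  forall M, argmin (lsq (M *m A) (M *m b)) (sol M).

(* Main.v *)
From HB Require Import structures.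
Require Import Defs.
From mathcomp Require Import ring lra measurable_realfun.
Import Order.TTheory GRing.Theory Num.Theory.
Import numFieldNormedType.Exports.
Local Open Scope classical_set_scope.
Local Open Scope ring_scope.

(** Since [xstar] minimizes [lsq A b], the residual [A xstar - b] is orthogonal
    to the range of [A], so [lsq A b x] exceeds [lsq A b xstar] by the squared
    norm of [A x - A xstar] ([lsq_argmin_decomp]). The claim is therefore about
    the mean square of the average of the i.i.d. random vectors
    [A xhat_k - A xstar], and the squared norm splits it into one claim per
    coordinate: for i.i.d. real variables Y_k distributed as Z,

      E[((Y_1 + ... + Y_q) / q)^2] = E[Z^2] / q + (q - 1) / q * E[Z]^2

    ([expectation_sqr_iid_average]). If E[Z^2] is finite, the square of the sum
    is expanded: the q diagonal terms give E[Z^2], and each of the q (q - 1)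
    off-diagonal terms gives E[Z]^2, by independence
    ([expectation_indep_mul]).

    No moment of the sketched solutions is assumed, so the case E[Z^2] = +oo
    has to be treated as well. Both sides are then infinite, because
    independent summands cannot cancel one another: if the sum is square
    integrable, so is each summand ([expectation_sqr_sum_lty]). If
    moreover E[Z] is not finite, [fine] turns it into some real number, which
    leaves an infinite right-hand side unchanged. *)

(** * Least squares *)

Lemma norm2_sqr (R : realType) (n : nat) (v : 'cV[R]_n) :
  norm2 v ^+ 2 = \sum_(i < n) v i 0 ^+ 2.
Proof. by rewrite sqr_sqrtr// sumr_ge0// => i _; exact: sqr_ge0. Qed.

(** Near 0 the linear term dominates; this is the first-order optimality
    condition, obtained without derivatives. *)
Lemma linear_quadratic_ge0_eq0 (R : realType) (a c : R) :
  (forall t, 0 <= t ^+ 2 * a + 2 * t * c) -> c = 0.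
Proof.
move=> h; apply/eqP/negP => /negP c0.
(* At t = - e c the quadratic is e c^2 (e a - 2), negative as e a < 1. *)
pose e := (`|a| + 1)^-1.
have e0 : 0 < e by rewrite invr_gt0 ltr_wpDl.
have ea : e * a < 1.
  have a1 : 0 < `|a| + 1 by rewrite ltr_wpDl.
  rewrite -(mulVf (lt0r_neq0 a1)) ltr_pM2l//.
  by rewrite (le_lt_trans (ler_norm a))// ltrDl.
have c2 : 0 < e * c ^+ 2 by rewrite mulr_gt0// exprn_even_gt0.
have := h (- (e * c)).
have -> : (- (e * c)) ^+ 2 * a + 2 * - (e * c) * c = e * c ^+ 2 * (e * a - 2).
  by ring.
by rewrite pmulr_rge0// => ?; lra.
Qed.

(** The normal equations, from the variations [xs + t *: y] of the
    minimizer. *)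
Lemma argmin_lsq_orthogonal (R : realType) (n d : nat) (A : 'M[R]_(n, d))
    (b : 'cV[R]_n) (xs : 'cV[R]_d) : argmin (lsq A b) xs ->
  forall y : 'cV[R]_d, \sum_(i < n) (A *m y) i 0 * (A *m xs - b) i 0 = 0.
Proof.
move=> xsmin y.
apply: (@linear_quadratic_ge0_eq0 _ (\sum_(i < n) (A *m y) i 0 ^+ 2)) => t.
have := xsmin (xs + t *: y).
rewrite -subr_ge0 /lsq !norm2_sqr.
rewrite mulmxDr -scalemxAr; set u := A *m y; set r := A *m xs.
rewrite -sumrB !mulr_sumr -big_split/=; congr (0 <= _).
by apply: eq_bigr => i _; rewrite !mxE; ring.
Qed.

(** Pythagoras: the cross term vanishes by the normal equations. *)
Lemma lsq_argmin_decomp (R : realType) (n d : nat) (A : 'M[R]_(n, d))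
    (b : 'cV[R]_n) (xs x : 'cV[R]_d) : argmin (lsq A b) xs ->
  lsq A b x = \sum_(i < n) ((A *m x - A *m xs) i 0) ^+ 2 + lsq A b xs.
Proof.
move=> /argmin_lsq_orthogonal/(_ (x - xs)) orth.
rewrite /lsq !norm2_sqr -[RHS]addr0.
have {orth} orth2 := congr1 ( *%R 2) orth; rewrite mulr0 in orth2.
rewrite -[X in _ = _ + X]orth2 mulmxBr mulr_sumr -!big_split/=.
by apply: eq_bigr => i _; rewrite !mxE; ring.
Qed.

(** * Independence and second moments *)

Section independence.
Context (R : realType) (disp : measure_display) (T : measurableType disp)
  (P : probability T R).

(** On Borel sets, the law of [X] under [P] restricted to [B] is [P B] times the
    law of [X]; both sides integrate [f] against this measure. *)
Lemma ge0_integral_indep_event (disp' : measure_display)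
    (T' : measurableType disp') (X : {RV P >-> T'}) (B : set T)
    (f : T' -> \bar R) :
    measurable B ->
    (forall C, measurable C -> P (X @^-1` C `&` B) = (P (X @^-1` C) * P B)%E) ->
    measurable_fun setT f -> (forall y, 0 <= f y)%E ->
  (\int[P]_(w in B) f (X w) = P B * \int[P]_w f (X w))%E.
Proof.
move=> mB indep mf f0.
have mX : measurable_fun setT X by [].
have mfX D : measurable_fun D (f \o X).
  by apply: measurable_funTS; exact: measurableT_comp.
have PB0 : 0 <= fine (P B) by rewrite fine_ge0.
transitivity (\int[mrestr P mB]_w (f \o X) w)%E.
  have nB : mrestr P mB (~` B) = 0%E by rewrite /mrestr setICl measure0.
  rewrite (ge0_negligible_integral (measurableC mB) measurableT (mfX _) _ nB);
    last by move=> *; exact: f0.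
  rewrite setTD setCK; apply: eq_measure_integral => A mA AB.
  by rewrite /= /mrestr setIidl.
have -> : (\int[P]_w f (X w) = \int[distribution P X]_y f y)%E.
  by rewrite ge0_integral_distribution.
have -> : P B = ((NngNum PB0)%:num)%:E by rewrite /= fineK// fin_num_measure.
rewrite -ge0_integral_mscale//.
transitivity (\int[pushforward (mrestr P mB) X]_y f y)%E.
  by rewrite ge0_integral_pushforward.
apply: eq_measure_integral => C mC _.
rewrite /mscale/= /pushforward/= /mrestr/= indep// muleC.
by rewrite /mscale [((NngNum PB0)%:num)%:E]fineK// fin_num_measure.
Qed.

(** Otherwise the whole space would be the union over the integers c of the null
    events that the absolute value of [X] is at most c. *)
Lemma exists_norm_le_gt0 (X : {RV P >-> R}) :
  exists c : R, (0 < P [set w | (`|X w| <= c)%R])%E.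
Proof.
apply: contrapT => /forallNP h.
have mX (c : R) : measurable [set w | `|X w| <= c].
  have := @measurable_funPTI _ _ _ _ X `[(- c), c]%classic (measurable_itv _).
  by congr measurable; apply/seteqP; split => w /=; rewrite in_itv/= ler_norml.
have : P.-negligible (\bigcup_(k : nat) [set w | `|X w| <= k%:R]).
  apply: negligible_bigcup => k; apply/negligibleP => //.
  by apply/eqP; rewrite -measure_le0 leNgt; apply/negP; exact: h.
have -> : \bigcup_(k : nat) [set w | `|X w| <= k%:R] = setT.
  apply/seteqP; split => // w _; exists (Num.truncn `|X w|).+1 => //=.
  by apply/ltW; rewrite truncnS_gt.
move/negligibleP => /(_ measurableT) PT0.
have := @probability_setT _ _ _ P.
by rewrite [X in X = _]PT0 => /esym/eqP; rewrite onee_eq0.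
Qed.

Lemma integrable_distribution (X : {RV P >-> R}) :
  P.-integrable setT (EFin \o X) -> (distribution P X).-integrable setT EFin.
Proof. by move=> iX; apply: integrable_pushforward. Qed.

(** Independence says that the joint law of [X] and [Y] agrees with the product
    of their laws on rectangles, hence everywhere; Fubini's theorem then
    separates the integral of the product of the coordinates. *)
Lemma expectation_indep_mul (X Y : {RV P >-> R}) :
    (forall B C, measurable B -> measurable C ->
      P (X @^-1` B `&` Y @^-1` C) = (P (X @^-1` B) * P (Y @^-1` C))%E) ->
    P.-integrable setT (EFin \o X) -> P.-integrable setT (EFin \o Y) ->
    P.-integrable setT (EFin \o (X \* Y)) ->
  ('E_P[X \* Y] = 'E_P[X] * 'E_P[Y])%E.
Proof.
move=> indep iX iY iXY.
have mXY : measurable_fun setT (fun w => (X w, Y w)) by exact: measurable_fun_pair.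
pose XY : {RV P >-> (R * R)%type} :=
  HB.pack (fun w => (X w, Y w)) (isMeasurableFun.Build _ _ _ _ _ mXY).
pose f := fun z : R * R => (z.1 * z.2)%:E.
have mf : measurable_fun setT f.
  by apply/measurable_EFinP; apply: measurable_funM.
have jointE A : measurable A ->
    (distribution P X \x distribution P Y)%E A = distribution P XY A.
  by apply: product_measure_unique => B C mB mC; rewrite -indep.
have if_ : (distribution P X \x distribution P Y)%E.-integrable setT f.
  apply/integrableP; split => //.
  rewrite (@eq_measure_integral _ _ _ _ (distribution P XY)); last first.
    by move=> A mA _; exact: jointE.
  rewrite ge0_integral_distribution//; last exact: measurableT_comp.
  by have /integrableP[] := iXY.
rewrite unlock.
transitivity (\int[P]_w (f \o XY) w)%E => //.
rewrite -integral_distribution//.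
rewrite (@eq_measure_integral _ _ _ _ (distribution P X \x distribution P Y)%E);
  last by move=> A mA _; exact/esym/jointE.
rewrite -integral12_prod_meas1// /fubini_F /f/=.
have EY : (\int[distribution P Y]_y y%:E = \int[P]_w (Y w)%:E)%E.
  by rewrite integral_distribution.
have iY' := integrable_distribution _ iY.
under eq_integral => x _.
  under eq_integral => y _ do rewrite EFinM.
  rewrite integralZl// EY.
  over.
rewrite -(@fineK _ (\int[P]_w (Y w)%:E)); last exact: integrable_fin_num.
have iX' := integrable_distribution _ iX.
by rewrite integralZr// integral_distribution.
Qed.

(** Let B be an event of positive probability on which all summands other than
    [Y k] are bounded. On B, the variable [Y k] differs from the sum S by at most
    a constant K, so that the square of [Y k] is at most 2 S^2 + 2 K^2 and has a
    finite integral over B. Since [Y k] is independent of B, that integral is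
    [P B] times the second moment of [Y k]. *)
Lemma expectation_sqr_sum_lty (I : finType) (Y : I -> {RV P >-> R}) (k : I) :
    mutually_independent Y ->
    ('E_P[fun w => ((\sum_l Y l w) ^+ 2)%R] < +oo ->
  'E_P[fun w => (Y k w ^+ 2)%R] < +oo)%E.
Proof.
move=> indep S2_lty.
have [c cP] := fin_all_exists (fun l => exists_norm_le_gt0 (Y l)).
pose D l := `[(- c l)%R, c l]%classic.
have mD l : measurable (D l) by exact: measurable_itv.
pose B := \bigcap_(l in [set` [set~ k]%SET]) Y l @^-1` D l.
have mB : measurable B.
  apply: fin_bigcap_measurable => // l _.
  by rewrite -[X in measurable X]setTI; exact: measurable_funPT.
have PBE : P B = (\prod_(l in [set~ k]%SET) P (Y l @^-1` D l))%E by exact: indep.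
have PB_gt0 : (0 < P B)%E.
  rewrite PBE; elim/big_ind : _ => [//|x y|l _]; first exact: mule_gt0.
  suff -> : Y l @^-1` D l = [set w | `|Y l w| <= c l] by exact: cP.
  by apply/seteqP; split => w /=; rewrite /D/= in_itv/= ler_norml.
(* [mutually_independent] is applied to the full index set, with the event of
   index k replaced by C. *)
have indepB C : measurable C ->
    P (Y k @^-1` C `&` B) = (P (Y k @^-1` C) * P B)%E.
  move=> mC; pose F l := if l == k then C else D l.
  have -> : Y k @^-1` C `&` B = \bigcap_(l in [set` [set: I]%SET]) Y l @^-1` F l.
    rewrite /F; apply/seteqP; split => w /=.
      move=> [Ckw Bw] l _ /=; case: eqP => [->//|/eqP lk].
      by apply: Bw => /=; rewrite !inE.
    move=> Fw; split; first by have := Fw k; rewrite /= eqxx; apply; rewrite inE.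
    move=> l /=; rewrite !inE => lk.
    by have := Fw l; rewrite /= (negbTE lk); apply; rewrite inE.
  rewrite indep => [|l _]; last by rewrite /F; case: ifP.
  rewrite (bigD1 k) ?inE//= {1}/F eqxx PBE; congr (_ * _)%E.
  apply: eq_big => [l|l]; first by rewrite !inE.
  by rewrite inE/= => lk; rewrite /F (negbTE lk).
pose K := \sum_(l | l != k) c l.
have mY l : measurable_fun setT (Y l) by [].
have mS : measurable_fun setT (fun w => \sum_l Y l w) by exact: measurable_sum.
have mYk2 A : measurable_fun A (fun w => (Y k w ^+ 2)%:E).
  by apply/measurable_funTS/measurable_EFinP; exact: measurable_funX.
have mS2 : measurable_fun setT (fun w => ((\sum_l Y l w) ^+ 2)%:E).
  by apply/measurable_EFinP; exact: measurable_funX.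
have mG A : measurable_fun A
    (fun w => 2%:E * ((\sum_l Y l w) ^+ 2)%:E + (2 * K ^+ 2)%:E)%E.
  apply: measurable_funTS; apply: emeasurable_funD => //.
  exact: measurable_funeM.
have G_ge0 w : (0 <= 2%:E * ((\sum_l Y l w) ^+ 2)%:E + (2 * K ^+ 2)%:E)%E.
  by rewrite -EFinM -EFinD lee_fin addr_ge0// mulr_ge0// sqr_ge0.
have : (P B * 'E_P[fun w => (Y k w ^+ 2)%R] < +oo)%E.
  rewrite unlock.
  rewrite -(@ge0_integral_indep_event _ _ _ _ (fun y : R => (y ^+ 2)%:E))//;
    last by move=> y; rewrite lee_fin sqr_ge0.
  2: by apply/measurable_EFinP; exact: measurable_funX.
  apply: (@le_lt_trans _ _
    (\int[P]_w (2%:E * ((\sum_l Y l w) ^+ 2)%:E + (2 * K ^+ 2)%:E))%E).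
    apply: (@le_trans _ _
      (\int[P]_(w in B) (2%:E * ((\sum_l Y l w) ^+ 2)%:E + (2 * K ^+ 2)%:E))%E).
      apply: ge0_le_integral => //.
      - by move=> w _; rewrite lee_fin sqr_ge0.
      - move=> w Bw; rewrite -EFinM -EFinD lee_fin (bigD1 k)//=.
        set z := \sum_(_ | _) _.
        have : `|z| <= K.
          apply: (le_trans (ler_norm_sum _ _ _)); apply: ler_sum => l lk.
          have := Bw l; rewrite /= !inE => /(_ lk).
          by rewrite /D/= in_itv/= ler_norml.
        rewrite ler_norml => /andP[? ?].
        have : z ^+ 2 <= K ^+ 2 by nra.
        (* 2 (y + z)^2 + 2 z^2 - y^2 = (y + 2 z)^2 *)
        by have := sqr_ge0 (Y k w + 2 * z); nra.
    exact: ge0_subset_integral.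
  have S2_ge0 w : [set: T] w -> (0 <= ((\sum_l Y l w) ^+ 2)%:E)%E.
    by rewrite lee_fin sqr_ge0.
  have S2x2_ge0 w : [set: T] w -> (0 <= 2%:E * ((\sum_l Y l w) ^+ 2)%:E)%E.
    by move=> Tw; rewrite mule_ge0// S2_ge0.
  have K2_ge0 w : [set: T] w -> (0 <= (2 * K ^+ 2)%:E)%E.
    by move=> _; rewrite lee_fin mulr_ge0// sqr_ge0.
  rewrite ge0_integralD//; last exact: measurable_funeM.
  rewrite ge0_integralZl//.
  rewrite integral_cst//= probability_setT mule1 lte_add_pinfty ?ltry//.
  by rewrite lte_mul_pinfty//; move: S2_lty; rewrite unlock.
have : (0 <= 'E_P[fun w => (Y k w ^+ 2)%R])%E.
  by apply: expectation_ge0 => w; exact: sqr_ge0.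
case: 'E_P[fun w => (Y k w ^+ 2)%R]%E => [r _ _| |//]; first by rewrite ltry.
by rewrite gt0_muley.
Qed.

Lemma ge0_integral_same_law (disp' : measure_display)
    (T' : measurableType disp') (X Y : {RV P >-> T'}) (f : T' -> \bar R) :
    same_law X Y -> measurable_fun setT f -> (forall y, 0 <= f y)%E ->
  (\int[P]_w f (X w) = \int[P]_w f (Y w))%E.
Proof.
move=> XY mf f0.
have Ef (Z : {RV P >-> T'}) :
    (\int[P]_w f (Z w) = \int[distribution P Z]_y f y)%E.
  by rewrite ge0_integral_distribution.
by rewrite !Ef; apply: eq_measure_integral => A mA _; exact: XY.
Qed.

Lemma expectation_same_law (X Y : {RV P >-> R}) : same_law X Y ->
    P.-integrable setT (EFin \o X) -> P.-integrable setT (EFin \o Y) ->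
  ('E_P[X] = 'E_P[Y])%E.
Proof.
move=> XY iX iY; rewrite !expectation_def.
rewrite -[LHS](@integral_distribution _ _ _ _ _ _ _ EFin)//.
rewrite -[RHS](@integral_distribution _ _ _ _ _ _ _ EFin)//.
by apply: eq_measure_integral => A mA _; exact: XY.
Qed.

(** The absolute value of x y is at most x^2 + y^2. *)
Lemma integrable_mul_sqr (X Y : {RV P >-> R}) :
    ('E_P[fun w => (X w ^+ 2)%R] < +oo)%E -> ('E_P[fun w => (Y w ^+ 2)%R] < +oo)%E ->
  P.-integrable setT (EFin \o (X \* Y)).
Proof.
have isqr (Z : {RV P >-> R}) : ('E_P[fun w => (Z w ^+ 2)%R] < +oo)%E ->
    P.-integrable setT (fun w => (Z w ^+ 2)%:E).
  rewrite unlock => Z2; apply/integrableP; split.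
    by apply/measurable_EFinP; exact: measurable_funX.
  by under eq_integral => w _ do rewrite gee0_abs ?lee_fin ?sqr_ge0//.
move=> /isqr iX /isqr iY.
apply: (le_integrable _ _ _ (integrableD _ iX iY)) => //.
  by apply/measurable_EFinP; exact: measurable_funM.
move=> w _ /=; rewrite lee_fin [leRHS]ger0_norm ?addr_ge0 ?sqr_ge0//.
rewrite ler_norml; have := sqr_ge0 (X w + Y w); have := sqr_ge0 (X w - Y w).
have := sqr_ge0 (X w); have := sqr_ge0 (Y w).
by move=> *; apply/andP; split; nra.
Qed.

Lemma integrable_sqr_lty (X : {RV P >-> R}) :
  ('E_P[fun w => (X w ^+ 2)%R] < +oo)%E -> P.-integrable setT (EFin \o X).
Proof.
move=> X2; have := @integrable_mul_sqr X (cst 1) X2.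
rewrite (_ : EFin \o (X \* cst 1) = EFin \o X).
  by apply; rewrite (_ : (fun _ => _) = cst 1) ?expectation_cst ?ltry//;
     apply/funext => w /=; rewrite expr1n.
by apply/funext => w /=; rewrite mulr1.
Qed.

(** The mean enters through a real number [e] that has to be equal to the
    expectation of [Z] only if [Z] is square integrable. The statement thus
    covers infinite second moments, for which both sides are +oo. *)
Lemma expectation_sqr_iid_average (q : nat) (Y : 'I_q -> {RV P >-> R})
    (Z : {RV P >-> R}) (e : R) :
    (0 < q)%N -> iid Y -> (forall k, same_law Z (Y k)) ->
    ('E_P[fun w => (Z w ^+ 2)%R] < +oo -> 'E_P[Z] = e%:E)%E ->
  ('E_P[fun w => ((q%:R^-1 * \sum_k Y k w) ^+ 2)%R] =
   (q%:R^-1)%:E * 'E_P[fun w => (Z w ^+ 2)%R] +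
   ((q%:R - 1) / q%:R * e ^+ 2)%:E)%E.
Proof.
move=> q0 [indep law] Zlaw eE.
have q0R : 0 < q%:R^-1 :> R by rewrite invr_gt0 ltr0n.
have mY l : measurable_fun setT (Y l) by [].
have mS : measurable_fun setT (fun w => \sum_l Y l w) by exact: measurable_sum.
have scaleE : ('E_P[fun w => ((q%:R^-1 * \sum_k Y k w) ^+ 2)%R] =
    (q%:R^-1 ^+ 2)%:E * 'E_P[fun w => ((\sum_k Y k w) ^+ 2)%R])%E.
  rewrite unlock; under eq_integral => w _ do rewrite exprMn EFinM.
  rewrite ge0_integralZl ?lee_fin ?sqr_ge0//.
    by apply/measurable_EFinP; exact: measurable_funX.
  by move=> w _; rewrite lee_fin sqr_ge0.
have sqrE k : ('E_P[fun w => (Y k w ^+ 2)%R] = 'E_P[fun w => (Z w ^+ 2)%R])%E.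
  rewrite unlock; apply/esym.
  apply: (@ge0_integral_same_law _ _ _ _ (fun y : R => (y ^+ 2)%:E)) => //.
    by apply/measurable_EFinP; exact: measurable_funX.
  by move=> y; rewrite lee_fin sqr_ge0.
have Z2_ge0 : (0 <= 'E_P[fun w => (Z w ^+ 2)%R])%E.
  by apply: expectation_ge0 => w; exact: sqr_ge0.
have [Z2|] := ltP ('E_P[fun w => (Z w ^+ 2)%R])%E +oo%E; last first.
  rewrite leye_eq => /eqP Z2; rewrite Z2 gt0_muley ?lte_fin// addye//.
  rewrite scaleE; set S2 := 'E_P[_]%E.
  have : ~ (S2 < +oo)%E.
    move=> /(@expectation_sqr_sum_lty _ _ (Ordinal q0) indep).
    by rewrite sqrE Z2.
  move/negP; rewrite -leNgt leye_eq => /eqP ->.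
  by rewrite gt0_muley// lte_fin exprn_gt0.
rewrite scaleE.
have iZ := @integrable_sqr_lty _ Z2.
have Y2 k : ('E_P[fun w => (Y k w ^+ 2)%R] < +oo)%E by rewrite sqrE.
have iY k := @integrable_sqr_lty _ (Y2 k).
have EY k : ('E_P[Y k] = e%:E)%E.
  by rewrite -eE//; apply/esym/expectation_same_law.
have iYY k l : P.-integrable setT (EFin \o (Y k \* Y l)).
  exact: integrable_mul_sqr.
pose s := fine ('E_P[fun w => (Z w ^+ 2)%R])%E.
have sE : ('E_P[fun w => (Z w ^+ 2)%R] = s%:E)%E by rewrite fineK// ge0_fin_numE.
have EYY k l : ('E_P[Y k \* Y l] = (if k == l then s else e ^+ 2)%:E)%E.
  case: eqP => [<-|/eqP kl].
    rewrite -sE -(sqrE k); congr ('E_P[_])%E.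
  rewrite expectation_indep_mul// ?EY// => B C mB mC.
  pose F i := if i == k then B else C.
  have := indep [set k; l]%SET F.
  rewrite big_setU1 ?inE//= big_set1 /F eqxx eq_sym (negbTE kl) => <-; last first.
    by move=> i _; case: ifP.
  congr (P _); apply/seteqP; split => w /=.
    move=> [Bw Cw] i /=; rewrite !inE => /orP[]/eqP ->; first by rewrite eqxx.
    by rewrite eq_sym (negbTE kl).
  move=> h; split; first by have := h k; rewrite /= eqxx !inE eqxx; apply.
  by have := h l; rewrite /= eq_sym (negbTE kl) !inE eqxx orbT; apply.
have -> : ('E_P[fun w => ((\sum_k Y k w) ^+ 2)%R] =
    \sum_k \sum_l 'E_P[Y k \* Y l])%E.
  rewrite unlock.
  under eq_integral => w _.
    rewrite expr2 mulr_suml -sumEFin.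
    under eq_bigr => k _ do rewrite mulr_sumr -sumEFin.
    over.
  rewrite (integral_sum measurableT) => [|k]; last first.
    by apply: (integrable_sum measurableT) => l _; exact: iYY.
  by apply: eq_bigr => k _; rewrite (integral_sum measurableT) => [|l] //; exact: iYY.
(* Each row of the double sum has one diagonal and q - 1 other entries. *)
have rowE k : (\sum_l 'E_P[Y k \* Y l] = (s + (q%:R - 1) * e ^+ 2)%:E)%E.
  under eq_bigr => l _ do rewrite EYY.
  rewrite sumEFin (bigD1 k)//= eqxx; congr (_ + _)%:E.
  under eq_bigr => l lk do rewrite eq_sym (negbTE lk).
  rewrite sumr_const cardC1 card_ord.
  by rewrite -subn1 -[LHS]mulr_natl natrB.
under eq_bigr => k _ do rewrite rowE.
rewrite sumEFin sumr_const card_ord sE -!EFinM -EFinD; congr (_%:E).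
rewrite -mulr_natl; field.
by rewrite pnatr_eq0 -lt0n.
Qed.

End independence.

(** * Functions of random matrices *)

(** Matrices carry the Borel sets of the product topology, for which the
    coordinates are continuous. *)
Lemma measurable_fun_coord (R : realType) (m n : nat) (i : 'I_m) (j : 'I_n) :
  measurable_fun setT (fun M : 'M[R]_(m, n) => M i j).
Proof.
apply: (measurability _ (RGenOpens.measurableE R)).
move=> _ [_ [a [b ->] <-]]; rewrite setTI; apply: sub_sigma_algebra.
apply: open_comp => [M _|]; last exact: interval_open.
exact: coord_continuous.
Qed.

Section transformed.
Context {R : realType} {disp d1 d2 : measure_display} {T : measurableType disp}
  {P : probability T R} {T1 : measurableType d1} {T2 : measurableType d2}
  {g : T1 -> T2} (mg : measurable_fun setT g).

Definition rv_comp (X : {RV P >-> T1}) : {RV P >-> T2} :=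
  HB.pack (g \o X)
    (isMeasurableFun.Build _ _ _ _ (g \o X) (measurableT_comp mg (measurable_funPT X))).

Lemma same_law_comp (X Y : {RV P >-> T1}) :
  same_law X Y -> same_law (rv_comp X) (rv_comp Y).
Proof.
move=> XY B mB; apply: (XY (g @^-1` B)).
by rewrite -[X in measurable X]setTI; exact: mg.
Qed.

Lemma iid_comp (I : finType) (X : I -> {RV P >-> T1}) :
  iid X -> iid (fun k => rv_comp (X k)).
Proof.
move=> [indep law]; split=> [J B mB|k l]; last exact: same_law_comp.
apply: (indep J (fun k => g @^-1` B k)) => k kJ.
by rewrite -[X in measurable X]setTI; apply: mg => //; exact: mB.
Qed.

End transformed.

(** * Error of the averaged estimator *)

Theorem mainTheorem10 (R : realType) (disp : measure_display)
    (T : measurableType disp) (P : probability T R)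
    (m n d q : nat) (q_gt0 : (0 < q)%N)
    (A : 'M[R]_(n, d)) (b : 'cV[R]_n)
    (xstar : 'cV[R]_d) (xstar_min : argmin (lsq A b) xstar)
    (S_ : 'I_q -> {RV P >-> 'M[R]_(m, n)}) (S_iid : iid S_)
    (S : {RV P >-> 'M[R]_(m, n)}) (S_law : forall k, same_law S (S_ k))
    (S_sketch : sketching S)
    (sol : 'M[R]_(m, n) -> 'cV[R]_d) (sol_argmin : sketched_argmin A b sol) :
  let xhat := fun w : T => sol (S w) in
  let xhat_ := fun (k : 'I_q) (w : T) => sol (S_ k w) in
  let xbar := fun w : T => q%:R^-1 *: \sum_(k < q) xhat_ k w in
  let EAxhat := map_mx fine (mx_expectation P (fun w => A *m xhat w)) in
  ('E_P[fun w => lsq A b (xbar w)] - (lsq A b xstar)%:E =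
   (q%:R^-1)%:E * 'E_P[fun w => (norm2 (A *m xhat w - A *m xstar) ^+ 2)%R] +
   ((q%:R - 1) / q%:R * norm2 (EAxhat - A *m xstar) ^+ 2)%:E)%E.
Proof.
move=> xhat xhat_ xbar EAxhat.
have [msol _] := sol_argmin.
pose c := A *m xstar.
pose g i (M : 'M[R]_(m, n)) := (A *m sol M - c) i 0.
have mg i : measurable_fun setT (g i).
  rewrite /g; under eq_fun do rewrite !mxE.
  apply: measurable_funB => //; apply: measurable_sum => j.
  apply: measurable_funM => //.
  exact: (measurableT_comp (measurable_fun_coord _ _ _ j 0) msol).
pose Y i k : {RV P >-> R} := rv_comp (mg i) (S_ k).
pose Z i : {RV P >-> R} := rv_comp (mg i) S.
pose e i := (EAxhat - c) i 0.
have xbarE i w : (A *m xbar w - c) i 0 = q%:R^-1 * \sum_k Y i k w.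
  rewrite /xbar -scalemxAr mulmx_sumr /Y/= /g mxE.
  rewrite (_ : \sum_k _ = \sum_k (A *m xhat_ k w) i 0 - q%:R * c i 0).
    by rewrite mulrBr mulKf ?pnatr_eq0 -?lt0n// !mxE summxE.
  have -> : q%:R * c i 0 = \sum_(k < q) c i 0.
    by rewrite sumr_const card_ord mulr_natl.
  rewrite -sumrB.
  by apply: eq_bigr => k _; rewrite !mxE.
(* E[A xhat] and E[A xhat - c] differ by c if the coordinate is integrable. *)
have EZ i : ('E_P[fun w => (Z i w ^+ 2)%R] < +oo -> 'E_P[Z i] = (e i)%:E)%E.
  move=> /integrable_sqr_lty iZ.
  have cE : ('E_P[fun w => ((A *m xhat w) i 0)%R] = 'E_P[Z i] + (c i 0)%:E)%E.
    rewrite -(expectation_cst P (c i 0)) -expectationD; last 2 first.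
    - exact/Lfun1_integrable.
    - exact: Lfun_cst.
    congr ('E_P[_])%E; apply/funext => w.
    by rewrite /Z/= /g [in RHS]mxE [X in _ + X + _]mxE subrK.
  have EZfin : 'E_P[Z i]%E \is a fin_num.
    exact/expectation_fin_num/Lfun1_integrable.
  by rewrite /e !mxE cE fineD// [fine (c i 0)%:E]mxE addrK fineK.
have mY i k : measurable_fun setT (Y i k) by [].
have mZ i : measurable_fun setT (Z i) by [].
have sum_sqrE (X : 'I_n -> T -> R) : (forall i, measurable_fun setT (X i)) ->
    ('E_P[fun w => (\sum_i X i w ^+ 2)%R] =
     \sum_i 'E_P[fun w => (X i w ^+ 2)%R])%E.
  move=> mX; rewrite unlock; under eq_integral do rewrite -sumEFin.
  rewrite ge0_integral_sum// => [i|i w _]; last by rewrite lee_fin sqr_ge0.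
  by apply/measurable_EFinP; exact: measurable_funX.
have mavg i : measurable_fun setT (fun w => q%:R^-1 * \sum_k Y i k w).
  by apply: measurable_funM => //; exact: measurable_sum.
have -> : ('E_P[fun w => lsq A b (xbar w)] =
    'E_P[fun w => (\sum_i (q%:R^-1 * \sum_k Y i k w) ^+ 2)%R] +
    (lsq A b xstar)%:E)%E.
  rewrite -[in RHS](expectation_cst P (lsq A b xstar)) unlock -ge0_integralD//.
  - apply: eq_integral => w _; rewrite (lsq_argmin_decomp _ _ _ _ _ _ _ xstar_min) EFinD.
    by under eq_bigr do rewrite xbarE.
  - by move=> w _; rewrite lee_fin sumr_ge0// => i _; exact: sqr_ge0.
  - apply/measurable_EFinP; apply: measurable_sum => i.
    exact: measurable_funX.
  - by move=> w _; rewrite lee_fin sqr_ge0.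
  - exact/measurable_EFinP/measurable_cst.
rewrite addeK// sum_sqrE//.
have -> : ('E_P[fun w => (norm2 (A *m xhat w - A *m xstar) ^+ 2)%R] =
    \sum_i 'E_P[fun w => (Z i w ^+ 2)%R])%E.
  by rewrite -sum_sqrE//; congr ('E_P[_])%E; apply/funext => w; rewrite norm2_sqr.
rewrite norm2_sqr mulr_sumr -sumEFin ge0_sume_distrr; last first.
  by move=> i _; apply: expectation_ge0 => w; exact: sqr_ge0.
rewrite -big_split/=; apply: eq_bigr => i _.
apply: (expectation_sqr_iid_average _ _ _ P q (Y i) (Z i) (e i)) => //.
- exact: iid_comp.
- by move=> k; exact: same_law_comp.
- exact: EZ.
Qed.
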